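(* Let $k$ be a field and let $\mathbb{B}$ be an atomless Boolean algebra with $0\neq1$. Then $\mathrm{pt}(\mathrm{IdemIdl}(\mathfrak{R}(\mathbb{B})))=\{\mathfrak{m}_{\mathbb{B}}\}$, where $\mathfrak{m}_{\mathbb{B}}$ is identified with the point it represents. That is, $\mathfrak{m}_{\mathbb{B}}$ is a prime element of the frame $\mathrm{IdemIdl}(\mathfrak{R}(\mathbb{B}))$, and the point of this frame corresponding to it is its only point.
   Context: A frame is a complete lattice in which finite meets distribute over arbitrary joins. A frame homomorphism preserves finite meets (including top) and arbitrary joins (including bottom). A point of a frame $L$ is a frame homomorphism $p\colon L\to\{0<1\}$, and $\mathrm{pt}(L)$ is the set of points. An element $q<1$ of $L$ is prime if $a\wedge b\leq q$ implies $a\leq q$ or $b\leq q$. Prime elements are in bijection with points: $q$ corresponds to the point $p_q$ with $p_q(a)=0$ if $a\leq q$ and $p_q(a)=1$ otherwise. For a commutative ring $A$, $\mathrm{IdemIdl}(A)$ is the poset, under inclusion, of ideals $I$ with $I^2=I$; it is a frame with joins $\bigvee_\alpha I_\alpha=\sum_\alpha I_\alpha$ and binary meets $I\wedge J=IJ$. An atom of a Boolean algebra is a minimal nonzero element; a Boolean algebra is atomless if it has no atoms. Nil-Cantor ring: for a Boolean algebra $\mathbb{B}$, $\mathfrak{R}(\mathbb{B})$ is the commutative $k$-algebra with $k$-basis $\{e_b\mid b\in\mathbb{B}\}$ and $k$-bilinear multiplication determined by $e_b\cdot e_c=e_{b\vee c}$ if $b\wedge c=0$ and $e_b\cdot e_c=0$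 otherwise; its unit is $e_0$. $\mathfrak{m}_{\mathbb{B}}$ is the kernel of the $k$-algebra homomorphism $\varepsilon\colon\mathfrak{R}(\mathbb{B})\to k$ with $\varepsilon(e_0)=1$ and $\varepsilon(e_b)=0$ for $b\neq0$. *)

(* Defs.v *)
From HB Require Import structures.
From mathcomp Require Import all_boot all_order all_algebra.
From mathcomp Require Import boolp classical_sets finmap.
From mathcomp.multinomials Require Import monalg.

Set Implicit Arguments.
Unset Strict Implicit.
Unset Printing Implicit Defensive.

Import Order.TTheory GRing.Theory.

Local Open Scope classical_set_scope.
Local Open Scope order_scope.

HB.mixin Record TBLattice_isFrame d T of Order.TBLattice d T := {
  joins : set T -> T;
  joins_ub : forall (S : set T) x, S x -> x <= joins S;
  joins_le : forall (S : set T) y, (forall x, S x -> x <= y) -> joins S <= y;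
  (* only the inequality that does not hold in every complete lattice *)
  meet_joins_le : forall x (S : set T),
    x `&` joins S <= joins [set x `&` y | y in S]
}.

#[short(type="frameType")]
HB.structure Definition Frame d :=
  {T of Order.TBLattice d T & TBLattice_isFrame d T}.

Section FrameTheory.
Context {d : Order.disp_t} {L : frameType d}.
Implicit Types (x y : L) (S : set L).

Lemma meet_joins x S : x `&` joins S = joins [set x `&` y | y in S].
Proof.
apply/le_anti; rewrite meet_joins_le /=; apply: joins_le => _ [y Sy <-].
by rewrite leI2 // joins_ub.
Qed.

Lemma joins0 : joins (set0 : set L) = \bot.
Proof. by apply/le_anti; rewrite le0x andbT; apply: joins_le. Qed.

End FrameTheory.

(* bool, with \bot = false, as the two-element frame {0 < 1} *)
Definition bool_joins (S : set bool) : bool := `[< S true >].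

Fact bool_joins_ub (S : set bool) x : S x -> x <= bool_joins S.
Proof. by case: x => // /asboolT; rewrite /bool_joins => ->. Qed.

Fact bool_joins_le (S : set bool) y :
  (forall x, S x -> x <= y) -> bool_joins S <= y.
Proof. by move=> Sy; rewrite /bool_joins; case: asboolP => // /Sy. Qed.

Fact bool_meet_joins_le x (S : set bool) :
  x `&` bool_joins S <= bool_joins [set x `&` y | y in S].
Proof.
rewrite {1}/bool_joins; case: asboolP => [ST|_]; last by rewrite meetx0 le0x.
by apply: bool_joins_ub; exists true.
Qed.

HB.instance Definition _ := TBLattice_isFrame.Build _ bool
  bool_joins_ub bool_joins_le bool_meet_joins_le.

Record frame_hom d d' (L : frameType d) (M : frameType d') := FrameHom {
  frame_fun :> L -> M;
  frame_homT : frame_fun \top = \top;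
  frame_homI : forall x y, frame_fun (x `&` y) = frame_fun x `&` frame_fun y;
  frame_hom_joins : forall S : set L,
    frame_fun (joins S) = joins (frame_fun @` S)
}.

Definition pt d (L : frameType d) := frame_hom L bool.

Definition prime_elt d (L : frameType d) (q : L) :=
  q < \top /\ forall a b : L, a `&` b <= q -> a <= q \/ b <= q.

Section PrimePoint.
Context d (L : frameType d) (q : L) (prime_q : prime_elt q).

Definition prime_fun (a : L) : bool := ~~ (a <= q).

Fact prime_funT : prime_fun \top = \top.
Proof. by rewrite /prime_fun (lt_geF (proj1 prime_q)). Qed.

Fact prime_funI a b : prime_fun (a `&` b) = prime_fun a `&` prime_fun b.
Proof.
rewrite /prime_fun -[RHS]/(~~ (a <= q) && ~~ (b <= q)) -negb_or; congr (~~ _).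
apply/idP/orP => [/(proj2 prime_q) //|[]]; apply: le_trans.
  exact: leIl.
exact: leIr.
Qed.

Fact prime_fun_joins (S : set L) :
  prime_fun (joins S) = joins (prime_fun @` S).
Proof.
rewrite -[RHS]/`[< (prime_fun @` S) true >]; apply/idP/asboolP => [|[a Sa /negP aq]].
  move/negP => Sq; apply: contrapT => noS; apply: Sq; apply: joins_le => a Sa.
  by apply/negPn/negP => aq; apply: noS; exists a.
by apply/negP => Sq; apply: aq; apply: le_trans Sq; apply: joins_ub.
Qed.

Definition prime_point : pt L := FrameHom prime_funT prime_funI prime_fun_joins.

End PrimePoint.

Section Ideals.
Local Open Scope ring_scope.
Context {A : comPzRingType}.
Implicit Types (I J K : set A) (F : set (set A)) (x y : A).

(* The unit ideal is allowed, unlike in ring_quotient's idealr_closed. *)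
Record is_ideal I : Prop := IsIdeal {
  ideal0 : I 0;
  idealD : forall x y, I x -> I y -> I (x + y);
  idealM : forall a x, I x -> I (a * x)
}.

Definition ideal_mul I J : set A :=
  [set x | exists2 s : seq (A * A),
     (forall p, p \in s -> I p.1 /\ J p.2) & x = \sum_(p <- s) p.1 * p.2].

Definition ideal_sum F : set A :=
  [set x | exists2 s : seq A,
     (forall a, a \in s -> exists2 I, F I & I a) & x = \sum_(a <- s) a].

Lemma ideal_sum_ideal F : (forall I, F I -> is_ideal I) ->
  is_ideal (ideal_sum F).
Proof.
move=> FI; split; first by exists [::]; rewrite ?big_nil.
  move=> x y [s sF ->] [t tF ->]; exists (s ++ t); last by rewrite big_cat.
  by move=> a; rewrite mem_cat => /orP[/sF|/tF].
move=> a x [s sF ->]; exists [seq a * y | y <- s].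
  by move=> _ /mapP[y /sF[I IF Iy] ->]; exists I => //; apply: idealM (FI _ IF) _ _ Iy.
by rewrite big_map mulr_sumr.
Qed.

Lemma ideal_sum_ub F I : F I -> I `<=` ideal_sum F.
Proof.
move=> FI x Ix; exists [:: x]; last by rewrite big_seq1.
by move=> a /[!inE] /eqP->; exists I.
Qed.

Lemma ideal_sum_le F K : is_ideal K -> (forall I, F I -> I `<=` K) ->
  ideal_sum F `<=` K.
Proof.
move=> idK FK x [s sF ->]; elim: s sF => [|a s IHs] sF.
  by rewrite big_nil; apply: ideal0.
rewrite big_cons; apply: idealD => //.
  by have [|I /FK IK /IK] := sF a; rewrite ?mem_head.
by apply: IHs => b sb; apply: sF; rewrite inE sb orbT.
Qed.

Lemma ideal_mul_ideal I J : is_ideal I -> is_ideal (ideal_mul I J).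
Proof.
move=> idI; split; first by exists [::]; rewrite ?big_nil.
  move=> x y [s sF ->] [t tF ->]; exists (s ++ t); last by rewrite big_cat.
  by move=> a; rewrite mem_cat => /orP[/sF|/tF].
move=> a x [s sF ->]; exists [seq (a * p.1, p.2) | p <- s].
  by move=> _ /mapP[p /sF[Ip Jp] ->]; split=> //=; apply: idealM.
by rewrite big_map mulr_sumr; apply: eq_bigr => p _; rewrite mulrA.
Qed.

Lemma ideal_mul_gen I J x y : I x -> J y -> ideal_mul I J (x * y).
Proof.
move=> Ix Jy; exists [:: (x, y)]; last by rewrite big_seq1.
by move=> p /[!inE] /eqP->.
Qed.

Lemma ideal_mul_le I J K : is_ideal K ->
  (forall x y, I x -> J y -> K (x * y)) -> ideal_mul I J `<=` K.
Proof.
move=> idK IJK x [s sF ->]; elim: s sF => [|a s IHs] sF.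
  by rewrite big_nil; apply: ideal0.
rewrite big_cons; apply: idealD => //.
  by have [|? ?] := sF a; rewrite ?mem_head //; apply: IJK.
by apply: IHs => b sb; apply: sF; rewrite inE sb orbT.
Qed.

Lemma ideal_mulS I I' J J' : I `<=` I' -> J `<=` J' ->
  ideal_mul I J `<=` ideal_mul I' J'.
Proof.
by move=> sI sJ x [s sIJ ->]; exists s => // p /sIJ[/sI ? /sJ ?].
Qed.

Lemma ideal_mul_subl I J : is_ideal I -> ideal_mul I J `<=` I.
Proof. by move=> ?; apply: ideal_mul_le => // x y ? _; rewrite mulrC; apply: idealM. Qed.

Lemma ideal_mul_subr I J : is_ideal J -> ideal_mul I J `<=` J.
Proof. by move=> ?; apply: ideal_mul_le => // x y _ ?; apply: idealM. Qed.

Lemma ideal_colon K a : is_ideal K -> is_ideal [set x | K (a * x)].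
Proof.
move=> idK; split=> /= [|x y Kx Ky|b x Kx].
- by rewrite mulr0; apply: ideal0.
- by rewrite mulrDr; apply: idealD.
- by rewrite mulrCA; apply: idealM.
Qed.

End Ideals.

Record idem_idl (A : comPzRingType) := IdemIdl {
  idl_set :> set A;
  idl_ideal : is_ideal idl_set;
  idl_idem : ideal_mul idl_set idl_set = idl_set
}.

HB.instance Definition _ (A : comPzRingType) := gen_eqMixin (idem_idl A).
HB.instance Definition _ (A : comPzRingType) := gen_choiceMixin (idem_idl A).

Fact idem_idl_display : Order.disp_t. Proof. exact: Order.Disp tt tt. Qed.

Section IdemIdlFrame.
Context {A : comPzRingType}.
Implicit Types (I J K : idem_idl A) (F : set (idem_idl A)).

Lemma idem_idl_inj I J : idl_set I = idl_set J -> I = J.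
Proof.
case: I J => [I idI II] [J idJ JJ] /= eqIJ.
by case: J / eqIJ idJ JJ => *; congr IdemIdl; apply: Prop_irrelevance.
Qed.

Definition idem_le I J : bool := `[< idl_set I `<=` idl_set J >].

Fact idem_le_refl : reflexive idem_le.
Proof. by move=> I; apply/asboolP. Qed.

Fact idem_le_anti : antisymmetric idem_le.
Proof.
move=> I J /andP[/asboolP IJ /asboolP JI].
by apply: idem_idl_inj; apply/seteqP.
Qed.

Fact idem_le_trans : transitive idem_le.
Proof.
by move=> J I K /asboolP IJ /asboolP JK; apply/asboolP; apply: subset_trans JK.
Qed.

HB.instance Definition _ := Order.Le_isPOrder.Build idem_idl_display
  (idem_idl A) idem_le_refl idem_le_anti idem_le_trans.

Lemma idem_leP I J : reflect (idl_set I `<=` idl_set J) (I <= J).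
Proof. exact: asboolP. Qed.

Fact idem_idl_of_sub (I : set A) : is_ideal I -> I `<=` ideal_mul I I ->
  ideal_mul I I = I.
Proof. by move=> idI II; apply/seteqP; split=> //; apply: ideal_mul_subl. Qed.

Fact idem_mul_idem I J :
  ideal_mul (ideal_mul I J) (ideal_mul I J) = ideal_mul I J.
Proof.
have [idI idJ] := (idl_ideal I, idl_ideal J).
have idIJ : is_ideal (ideal_mul I J) by apply: ideal_mul_ideal.
have idK := ideal_mul_ideal (ideal_mul I J) idIJ.
apply: idem_idl_of_sub => //; apply: ideal_mul_le => // x y Ix Jy.
suff sI : ideal_mul I I `<=` [set x | ideal_mul (ideal_mul I J) (ideal_mul I J)
    (y * x)%R] by rewrite mulrC; apply: sI; rewrite idl_idem.
apply: (ideal_mul_le (ideal_colon y idK)) => {x Ix} x x' Ix Ix' /=.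
suff sJ : ideal_mul J J `<=` [set y | ideal_mul (ideal_mul I J) (ideal_mul I J)
    (x * x' * y)%R] by rewrite mulrC; apply: sJ; rewrite idl_idem.
apply: (ideal_mul_le (ideal_colon (x * x')%R idK)) => {y Jy} y y' Jy Jy' /=.
by rewrite mulrACA; apply: ideal_mul_gen; apply: ideal_mul_gen.
Qed.

Definition idem_meet I J : idem_idl A :=
  IdemIdl (ideal_mul_ideal J (idl_ideal I)) (idem_mul_idem I J).

Fact idem_sum_ideal F : is_ideal (ideal_sum (@idl_set A @` F)).
Proof. by apply: ideal_sum_ideal => _ [I _ <-]; apply: idl_ideal. Qed.

Fact idem_sum_idem F :
  ideal_mul (ideal_sum (@idl_set A @` F)) (ideal_sum (@idl_set A @` F)) =
  ideal_sum (@idl_set A @` F).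
Proof.
have idF := idem_sum_ideal F.
apply: idem_idl_of_sub => //; apply: ideal_sum_le.
  exact: ideal_mul_ideal.
move=> _ [I FI <-]; rewrite -[X in X `<=` _]idl_idem.
by apply: ideal_mulS; apply: ideal_sum_ub; exists I.
Qed.

Definition idem_joins F : idem_idl A :=
  IdemIdl (idem_sum_ideal F) (idem_sum_idem F).

Fact idem_joins_ub F I : F I -> I <= idem_joins F.
Proof. by move=> FI; apply/idem_leP; apply: ideal_sum_ub; exists I. Qed.

Fact idem_joins_le F J : (forall I, F I -> I <= J) -> idem_joins F <= J.
Proof.
move=> FJ; apply/idem_leP; apply: ideal_sum_le; first exact: idl_ideal.
by move=> _ [I FI <-]; apply/idem_leP/FJ.
Qed.

Fact idem_meetP I J K : (I <= idem_meet J K) = (I <= J) && (I <= K).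
Proof.
apply/idem_leP/andP => [IJK|[/idem_leP IJ /idem_leP IK]].
  by split; apply/idem_leP; apply: (subset_trans IJK);
    [apply: ideal_mul_subl|apply: ideal_mul_subr]; apply: idl_ideal.
by rewrite -(idl_idem I); apply: ideal_mulS.
Qed.

Fact idem_joinP I J K :
  (idem_joins [set I; J] <= K) = (I <= K) && (J <= K).
Proof.
apply/idP/andP => [IJK|[IK JK]].
  by split; apply: le_trans IJK; apply: idem_joins_ub; [left|right].
by apply: idem_joins_le => _ [->|->].
Qed.

HB.instance Definition _ := Order.POrder_MeetJoin_isLattice.Build
  idem_idl_display (idem_idl A) idem_meetP idem_joinP.

Fact idem_bot_le I : idem_joins set0 <= I.
Proof. exact: idem_joins_le. Qed.

HB.instance Definition _ :=
  Order.hasBottom.Build idem_idl_display (idem_idl A) idem_bot_le.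

Fact idem_top_ideal : is_ideal [set: A]. Proof. by []. Qed.

Fact idem_top_idem : ideal_mul [set: A] [set: A] = [set: A].
Proof.
apply: idem_idl_of_sub => // x _.
by rewrite -[x]mulr1; apply: ideal_mul_gen.
Qed.

Fact idem_le_top I : I <= IdemIdl idem_top_ideal idem_top_idem.
Proof. exact/idem_leP. Qed.

HB.instance Definition _ :=
  Order.hasTop.Build idem_idl_display (idem_idl A) idem_le_top.

Fact idem_meet_joins_le I F :
  I `&` idem_joins F <= idem_joins [set I `&` J | J in F].
Proof.
have idK := idem_sum_ideal [set I `&` J | J in F].
apply/idem_leP; apply: ideal_mul_le => // x y Ix.
suff: ideal_sum (@idl_set A @` F) `<=` [set y | ideal_sum
    (@idl_set A @` [set I `&` J | J in F]) (x * y)%R] by apply.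
apply: (ideal_sum_le (ideal_colon x idK)) => _ [J FJ <-] {}y Jy /=.
apply: (@ideal_sum_ub _ _ (idl_set (I `&` J))).
  by exists (I `&` J) => //; exists J.
exact: ideal_mul_gen.
Qed.

HB.instance Definition _ := TBLattice_isFrame.Build idem_idl_display
  (idem_idl A) idem_joins_ub idem_joins_le idem_meet_joins_le.

Lemma idem_meetE I J : idl_set (I `&` J) = ideal_mul I J.
Proof. by []. Qed.

Lemma idem_joinsE F : idl_set (joins F) = ideal_sum (@idl_set A @` F).
Proof. by []. Qed.

End IdemIdlFrame.

Definition is_atom d (B : ctbDistrLatticeType d) (a : B) :=
  a != \bot /\ forall b : B, b != \bot -> b <= a -> b = a.

Definition atomless d (B : ctbDistrLatticeType d) :=
  forall a : B, ~ is_atom a.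

(* {malg k[B]} is the k-vector space of finitely supported functions B -> k,
   with basis << 1 *g b >> for b : B; it carries no multiplication here. *)
Definition nil_cantor (k : fieldType) d (B : ctbDistrLatticeType d) :=
  {malg k[B]}.

Section NilCantor.
Context {k : fieldType} {d : Order.disp_t} {B : ctbDistrLatticeType d}.
Local Open Scope ring_scope.
Local Notation R := (nil_cantor k B).
Implicit Types (b c e : B) (u v w : R) (a : k).

HB.instance Definition _ := GRing.Lmodule.on R.

Definition nc_basis b : R := << 1 *g b >>.

Definition nc_basis_mul b c : R :=
  if (b `&` c)%O == \bot%O then nc_basis (b `|` c)%O else 0.

Definition nc_mul u v : R :=
  \sum_(b <- msupp u) \sum_(c <- msupp v) (u@_b * v@_c) *: nc_basis_mul b c.

Let lin (V : lmodType k) (f : B -> V) u : V :=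
  \sum_(b <- msupp u) u@_b *: f b.

Let linEw (V : lmodType k) (f : B -> V) u (D : {fset B}) : (msupp u `<=` D)%fset ->
  lin f u = \sum_(b <- D) u@_b *: f b.
Proof.
move=> uD; rewrite /lin (big_fset_incl _ uD) // => b _ bu.
by rewrite mcoeff_outdom // scale0r.
Qed.

Let lin_lin (V : lmodType k) (f : B -> V) a u v : lin f (a *: u + v) = a *: lin f u + lin f v.
Proof.
pose D := (msupp (a *: u + v) `|` (msupp u `|` msupp v))%fset.
rewrite !(@linEw _ _ _ D) ?fsubsetUl //; last 2 first.
- by apply: fsubset_trans (fsubsetUr _ _); rewrite fsubsetUr.
- by apply: fsubset_trans (fsubsetUr _ _); rewrite fsubsetUl.
rewrite scaler_sumr -big_split; apply: eq_bigr => b _ /=.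
by rewrite mcoeffD mcoeffZ scalerDl scalerA.
Qed.

Let lin_basis (V : lmodType k) (f : B -> V) b : lin f (nc_basis b) = f b.
Proof.
rewrite (@linEw _ _ _ [fset b]%fset) ?msuppU_le //.
by rewrite big_seq_fset1 mcoeffUU scale1r.
Qed.

Lemma nc_basisE u : u = \sum_(b <- msupp u) u@_b *: nc_basis b.
Proof.
rewrite {1}(monalgE u); apply: eq_bigr => b _.
by apply/malgP => c; rewrite mcoeffZ !mcoeffU mulrnAr mulr1.
Qed.

Lemma nc_basis_free u : (forall b, u@_b = 0) -> u = 0.
Proof. by move=> u0; apply/malgP => b; rewrite u0 mcoeff0. Qed.

Let lin_ext (V : lmodType k) (f g : R -> V) :
  (forall a u v, f (a *: u + v) = a *: f u + f v) ->
  (forall a u v, g (a *: u + v) = a *: g u + g v) ->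
  (forall b, f (nc_basis b) = g (nc_basis b)) -> forall u, f u = g u.
Proof.
have lin0 (h : R -> V) : (forall a u v, h (a *: u + v) = a *: h u + h v) ->
    h 0 = 0.
  by move=> hl; have := hl (-1) 0 0; rewrite scaler0 add0r scaleN1r addNr.
move=> fl gl fg u; rewrite (nc_basisE u); elim: (enum_fset _) => [|b s IHs].
  by rewrite big_nil !lin0.
by rewrite big_cons fl gl fg IHs.
Qed.

Let nc_mulE u v : nc_mul u v = lin (fun b => lin (nc_basis_mul b) v) u.
Proof.
apply: eq_bigr => b _; rewrite scaler_sumr.
by apply: eq_bigr => c _; rewrite scalerA.
Qed.

Let nc_mul_linl w a u v :
  nc_mul (a *: u + v) w = a *: nc_mul u w + nc_mul v w.
Proof. by rewrite !nc_mulE lin_lin. Qed.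

Let nc_mul_linr w a u v :
  nc_mul w (a *: u + v) = a *: nc_mul w u + nc_mul w v.
Proof.
rewrite !nc_mulE /lin scaler_sumr -big_split; apply: eq_bigr => b _ /=.
have := lin_lin (nc_basis_mul b) a u v; rewrite /lin => ->.
by rewrite scalerDr !scalerA mulrC.
Qed.

Let nc_mul_basis b c : nc_mul (nc_basis b) (nc_basis c) = nc_basis_mul b c.
Proof. by rewrite nc_mulE !lin_basis. Qed.

Let nc_mul0 u : nc_mul u 0 = 0.
Proof. by rewrite /nc_mul msupp0 big1 // => b _; rewrite big_seq_fset0. Qed.

Let nc_mulC : commutative nc_mul.
Proof.
move=> u v; move: u; apply: lin_ext => [||b].
- exact: nc_mul_linl.
- exact: nc_mul_linr.
move: v; apply: lin_ext => [||c].
- exact: nc_mul_linr.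
- exact: nc_mul_linl.
by rewrite !nc_mul_basis /nc_basis_mul meetC joinC.
Qed.

Let nc_mulA : associative nc_mul.
Proof.
move=> u v w; move: u; apply: lin_ext => [a u u'|a u u'|b].
- exact: nc_mul_linl.
- by rewrite !nc_mul_linl.
move: v; apply: lin_ext => [a v v'|a v v'|c].
- by rewrite nc_mul_linl nc_mul_linr.
- by rewrite nc_mul_linr nc_mul_linl.
move: w; apply: lin_ext => [a w w'|a w w'|e].
- by rewrite !nc_mul_linr.
- exact: nc_mul_linr.
rewrite !nc_mul_basis /nc_basis_mul.
have [bc|bc] := eqVneq (b `&` c)%O \bot%O; have [ce|ce] := eqVneq (c `&` e)%O \bot%O.
- by rewrite !nc_mul_basis /nc_basis_mul meetUl meetUr bc ce joinx0 join0x joinA.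
- rewrite nc_mul0 nc_mul_basis /nc_basis_mul meetUl join_eq0 (negPf ce).
  by rewrite andbF.
- rewrite [nc_mul 0 _]nc_mulC nc_mul0 nc_mul_basis /nc_basis_mul meetUr join_eq0 (negPf bc).
  by [].
- by rewrite [nc_mul 0 _]nc_mulC !nc_mul0.
Qed.

Let nc_mul1 : left_id (nc_basis \bot%O) nc_mul.
Proof.
apply: lin_ext => [a u v|a u v|b]; first exact: nc_mul_linr.
  by [].
by rewrite nc_mul_basis /nc_basis_mul meet0x eqxx join0x.
Qed.

Let nc_mulDl : left_distributive nc_mul +%R.
Proof. by move=> u v w; have := nc_mul_linl w 1 u v; rewrite !scale1r. Qed.

Let nc_oner_neq0 : nc_basis \bot%O != 0 :> R.
Proof. by rewrite monalgU_eq0 oner_eq0. Qed.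

HB.instance Definition _ := GRing.Zmodule_isComNzRing.Build R
  nc_mulA nc_mulC nc_mul1 nc_mulDl nc_oner_neq0.

Fact nc_scalerAl a u v : a *: (u * v) = (a *: u) * v.
Proof.
have := nc_mul_linl v a u 0; rewrite addr0.
rewrite -[_ * _]/(nc_mul _ _) -[a *: u * v]/(nc_mul (a *: u) v) => ->.
by rewrite [nc_mul 0 v]nc_mulC nc_mul0 addr0.
Qed.

HB.instance Definition _ := GRing.Lmodule_isLalgebra.Build k R nc_scalerAl.
HB.instance Definition _ := GRing.Lalgebra_isComAlgebra.Build k R.

Lemma nc_one : 1 = nc_basis \bot%O :> R.
Proof. by []. Qed.

Lemma nc_basisM b c : nc_basis b * nc_basis c =
  if (b `&` c)%O == \bot%O then nc_basis (b `|` c)%O else 0.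
Proof. exact: nc_mul_basis. Qed.

(* the k-algebra map with e_0 |-> 1 and e_b |-> 0 for b != 0 *)
Definition nc_aug u : k := u@_(\bot%O).

Lemma nc_aug_basis b : nc_aug (nc_basis b) = (b == \bot%O)%:R.
Proof. by rewrite /nc_aug mcoeffU. Qed.

Fact nc_aug_is_additive : zmod_morphism nc_aug.
Proof. by move=> u v; rewrite /nc_aug mcoeffB. Qed.

Fact nc_aug_is_scalable : scalable_for *%R nc_aug.
Proof. by move=> a u; rewrite /nc_aug mcoeffZ. Qed.

Fact nc_aug_is_monoid_morphism : monoid_morphism nc_aug.
Proof.
split; first by rewrite nc_one nc_aug_basis eqxx.
move=> u v; move: u.
apply: (@lin_ext k^o) => [a u u'|a u u'|b].
- by rewrite mulrDl -scalerAl /nc_aug mcoeffD mcoeffZ.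
- by rewrite /nc_aug mcoeffD mcoeffZ mulrDl -mulrA.
move: v; apply: (@lin_ext k^o) => [a v v'|a v v'|c].
- by rewrite mulrDr -scalerAr /nc_aug mcoeffD mcoeffZ.
- by rewrite /nc_aug mcoeffD mcoeffZ mulrDr mulrCA.
rewrite nc_basisM !nc_aug_basis -natrM mulnb; case: eqP => [_|bc].
  by rewrite nc_aug_basis join_eq0.
case: eqP => [b0|_]; last by rewrite /nc_aug mcoeff0.
by case: bc; rewrite b0 meet0x.
Qed.

HB.instance Definition _ :=
  GRing.isZmodMorphism.Build R k nc_aug nc_aug_is_additive.
HB.instance Definition _ :=
  GRing.isMonoidMorphism.Build R k nc_aug nc_aug_is_monoid_morphism.
HB.instance Definition _ :=
  GRing.isScalable.Build k R k *%R nc_aug nc_aug_is_scalable.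

End NilCantor.

Definition nc_max (k : fieldType) d (B : ctbDistrLatticeType d) :
  set (nil_cantor k B) := [set u | nc_aug u = 0%R].

Arguments nc_max k {d} B _.

(* Main.v *)
Require Import Defs.
From mathcomp Require Import all_boot all_order all_algebra.
From mathcomp Require Import boolp classical_sets.
From mathcomp Require Import finmap.
From mathcomp.multinomials Require Import monalg.

Import Order.Theory GRing.Theory.

Local Open Scope classical_set_scope.
Local Open Scope order_scope.

(** Write [m] for the augmentation ideal, spanned by the [e_b] with [b != 0].
As [B] is atomless, every such [b] is a disjoint join [c \/ c'] of nonzero
elements, so [e_b = e_c * e_c'] and [m] is idempotent; it is prime in the frame
because it is the kernel of a ring morphism to a field.

Let [p] be any point. Each [e_b] with [b != 0] squares to zero, so an ideal not
contained in [m] contains a nonzero scalar up to nilpotents, hence is the unit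
ideal ([ideal_not_nc_max]), and [p] maps it to 1. It remains to see that
[p m = 0] ([pt_nc_max]), since then [p] is 0 on every idempotent ideal below
[m]. Suppose [p m = 1]. The join of all idempotent ideals sent to 0 is sent to
0, so it misses some [e_b] with [b != 0]; in other words [p I = 1] for every
idempotent ideal [I] containing [e_b]. Two such ideals with zero product give
the contradiction [1 = p I /\ p J = p 0 = 0].

To build them ([basis_idem_orthogonal]), iterate a cutting of nonzero elements
into four disjoint nonzero quarters, arranged as a two-by-two square. The
horizontal bands of [b] obtained by following only the row coordinate form a
binary tree rooted at [b] in which every node is the disjoint join of its two
children, so the corresponding basis elements generate an idempotent ideal.
The vertical bands give another one. Every horizontal band meets every vertical
band, so the product of a generator of the first ideal and a generator of the
second is zero. *)

(** * Points of a frame *)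

Section FramePoint.
Context {d : Order.disp_t} {L : frameType d}.
Implicit Types p : pt L.

Lemma pt_inj p p' : frame_fun p =1 frame_fun p' -> p = p'.
Proof.
case: p p' => f fT fI fJ [g gT gI gJ] /= /funext fg.
by case: g / fg gT gI gJ => *; congr FrameHom; apply: Prop_irrelevance.
Qed.

Lemma pt_le p (a b : L) : a <= b -> p a -> p b.
Proof.
move=> /meet_idPl ab pa; move: (frame_homI p a b).
by rewrite ab pa -[_ `&` _]/(p b).
Qed.

Lemma pt_bot p : p \bot = false.
Proof.
rewrite -joins0 frame_hom_joins image_set0.
by apply: asboolF.
Qed.

Lemma pt_joins_false p : p (joins [set a | p a = false]) = false.
Proof.
rewrite frame_hom_joins; apply: asboolF => -[a /= pa].
by rewrite pa.
Qed.

End FramePoint.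

(** * Idempotent ideals given by generators *)

Section Ideals.
Local Open Scope ring_scope.
Context {A : comPzRingType}.
Implicit Types (I S : set A) (x y : A).

Lemma ideal_big I (T : Type) (r : seq T) (P : pred T) (f : T -> A) :
  is_ideal I -> (forall i, P i -> I (f i)) -> I (\sum_(i <- r | P i) f i).
Proof. by case=> I0 ID _ If; elim/big_ind: _. Qed.

(** The ideal generated by [S], written as a product with the unit ideal so that
the lemmas on [ideal_mul] apply to an arbitrary set [S]. *)
Definition ideal_span S : set A := ideal_mul setT S.

Lemma ideal_span_ideal S : is_ideal (ideal_span S).
Proof. exact: ideal_mul_ideal. Qed.

Lemma ideal_span_gen S x : S x -> ideal_span S x.
Proof. by move=> Sx; rewrite -[x]mul1r; apply: ideal_mul_gen. Qed.

Lemma ideal_span_le S I : is_ideal I -> S `<=` I -> ideal_span S `<=` I.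
Proof. by move=> idI SI; apply: ideal_mul_le => // x y _ /SI; apply: idealM. Qed.

Lemma ideal_span_idem S :
  (forall x, S x -> exists y z, [/\ S y, S z & x = y * z]) ->
  ideal_mul (ideal_span S) (ideal_span S) = ideal_span S.
Proof.
have idS := ideal_span_ideal S => SS; apply: idem_idl_of_sub => //.
apply: ideal_span_le; first exact: ideal_mul_ideal.
by move=> _ /SS[y [z [Sy Sz ->]]]; apply: ideal_mul_gen; apply: ideal_span_gen.
Qed.

Lemma ideal_span_mul0 S S' : (forall x y, S x -> S' y -> x * y = 0) ->
  ideal_mul (ideal_span S) (ideal_span S') `<=` [set 0].
Proof.
have id0 : is_ideal [set 0 : A].
  by split=> [|x y -> ->|a x ->] //=; rewrite ?addr0 ?mulr0.
move=> SS'; apply: ideal_mul_le => // x y + S'y.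
apply: (ideal_span_le S [set x | x * y = 0]) => [|{}x Sx] /=.
  split=> [|u v /= u0 v0|a u /= u0]; first exact: mul0r.
    by rewrite mulrDl u0 v0 addr0.
  by rewrite -mulrA u0 mulr0.
apply: (ideal_span_le S' [set y | x * y = 0]) S'y => [|{}y S'y] /=.
  exact: ideal_colon id0.
exact: SS'.
Qed.

(** Square-zero elements do not change the radical of an ideal: if [x * x = 0],
then [(w + x) * (w - x) = w ^+ 2], which removes [x] at the cost of doubling
the exponent. *)
Lemma ideal_exp_nil I (r : seq A) v n : is_ideal I ->
  (forall x, x \in r -> x * x = 0) -> I ((v + \sum_(x <- r) x) ^+ n) ->
  exists N, I (v ^+ N).
Proof.
move=> idI; elim: r n => [|x r IHr] n r0.
  by rewrite big_nil addr0; exists n.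
rewrite big_cons addrCA; set w := v + _ => Iw.
apply: (IHr (2 * n)%N) => [y yr|]; first by rewrite r0 // inE yr orbT.
have -> : w ^+ (2 * n) = (w - x) ^+ n * (x + w) ^+ n.
  rewrite -exprMn_comm; last exact: mulrC.
  by rewrite [x + w]addrC -subr_sqr [x ^+ 2]expr2 r0 ?mem_head // subr0 exprM.
exact: idealM.
Qed.

End Ideals.

(** * Bands in an atomless Boolean algebra *)

Section Splitting.
Context {d : Order.disp_t} {B : ctbDistrLatticeType d}.
Implicit Types (a b : B) (s : seq bool).

(** The zero element is split into two zeros, so that [h] is a total function
whose first two properties hold without a side condition. *)
Lemma atomless_split : atomless B -> exists h : B -> bool -> B, forall a,
  [/\ a = h a false `|` h a true, h a false `&` h a true = \bot
    & a != \bot -> forall i, h a i != \bot].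
Proof.
move=> aB; suff /choice[l lP] : forall a, exists l, l <= a /\
    (a != \bot -> l != \bot /\ l != a).
  exists (fun a i => if i then l a else a `\` l a) => a; have [la nz] := lP a.
  split=> [||/nz[l0 lNa] []] //; first by rewrite leBUK.
    by rewrite diffIK.
  by rewrite diff_eq0; apply: contra lNa => al; rewrite eq_le la.
move=> a; have [->|a0] := eqVneq a \bot; first by exists \bot.
apply: contrapT => noS; apply: (aB a); split=> // b b0 ba.
apply: contrapT => /eqP bNa; apply: noS; exists b; split=> //.
Qed.

(** The quarter [q a i j] is thought of as lying in row [i] and column [j] of a
two-by-two square [a]. *)
Record quartering (q : B -> bool -> bool -> B) : Prop := Quartering {
  quarter_cover : forall a, a = (q a false false `|` q a false true) `|`
    (q a true false `|` q a true true);
  quarter_disj : forall a i j i' j', (i, j) != (i', j') ->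
    q a i j `&` q a i' j' = \bot;
  quarter_neq0 : forall a i j, a != \bot -> q a i j != \bot
}.

Lemma quartering_tr q : quartering q -> quartering (fun a i j => q a j i).
Proof.
case=> cov dis nz; split=> [a|a i j i' j' ij|a i j]; last exact: nz.
  by rewrite joinACA -cov.
apply: dis; apply: contra ij => /eqP[-> ->].
by [].
Qed.

Lemma atomless_quartering : atomless B -> exists q, quartering q.
Proof.
move=> /atomless_split[h hP]; exists (fun a i j => h (h a i) j).
have cov a : h a false `|` h a true = a by case: (hP a).
have dis a i i' : i != i' -> h a i `&` h a i' = \bot.
  by case: i i' (hP a) => -[] // [_ + _] _ => // h0; rewrite meetC.
have leh a i : h a i <= a.
  by rewrite -{2}(cov a); case: i; rewrite ?leUl ?leUr.
split=> [a|a i j i' j'|a i j a0]; first by rewrite !cov.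
  have [<-|ii' _] := eqVneq i i'.
    by rewrite xpair_eqE eqxx /=; apply: dis.
  by apply/eqP; rewrite -lex0 -(dis a _ _ ii') leI2.
have [_ _ nz] := hP a; have [_ _ nz'] := hP (h a i).
by apply/nz'/nz.
Qed.

(** Iterating [q] gives each part of [a] a row coordinate and a column
coordinate, both in binary. The element [row_band q a s] is the horizontal
band of the parts whose row coordinate starts with [s]; transposing [q] gives
the vertical bands. *)
Fixpoint row_band (q : B -> bool -> bool -> B) a s : B :=
  if s is i :: s' then
    row_band q (q a i false) s' `|` row_band q (q a i true) s'
  else a.

Context {q : B -> bool -> bool -> B} (qq : quartering q).

Lemma quarter_le a i j : q a i j <= a.
Proof.
have := lexx a; rewrite {1}(quarter_cover _ qq a) !leUx.
by case: i; case: j => /andP[/andP[] ? ? /andP[]].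
Qed.

Lemma row_band_le a s : row_band q a s <= a.
Proof.
elim: s a => [|i s IHs] a //=.
by rewrite leUx !(le_trans (IHs _)) ?quarter_le.
Qed.

(** Together with [row_band_disj], this makes the bands a binary tree in which
each node is the disjoint join of its children: all that is needed for the
basis elements of the bands to generate an idempotent ideal. *)
Lemma row_band_split a s : row_band q a s =
  row_band q a (rcons s false) `|` row_band q a (rcons s true).
Proof.
elim: s a => [|i s IHs] a /=; first exact: quarter_cover.
by rewrite (IHs (q a i false)) (IHs (q a i true)) joinACA.
Qed.

Lemma row_band_disj a s :
  row_band q a (rcons s false) `&` row_band q a (rcons s true) = \bot.
Proof.
have disj0 (x y x' y' : B) :
  x <= x' -> y <= y' -> x' `&` y' = \bot -> x `&` y == \bot.
  by move=> xx' yy' xy0; rewrite -lex0 -xy0 leI2.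
elim: s a => [|i s IHs] a; apply/eqP; rewrite /= meetUl !meetUr !join_eq0.
  by rewrite !(quarter_disj _ qq) ?eqxx.
by rewrite !IHs !eqxx /= andbT; apply/andP; split;
  apply: disj0 (row_band_le _ _) (row_band_le _ _) _; rewrite (quarter_disj _ qq) // xpair_eqE eqxx.
Qed.

End Splitting.

(** Row and column coordinates are independent: for row prefix [i :: s] and
column prefix [j :: t], both bands of [a] contain the corresponding bands,
with prefixes [s] and [t], of the one quarter [q a i j]. *)
Lemma row_col_band_neq0 d (B : ctbDistrLatticeType d)
    (q : B -> bool -> bool -> B) (a : B) (s t : seq bool) :
  quartering q -> a != \bot ->
  row_band q a s `&` row_band (fun x i j => q x j i) a t != \bot.
Proof.
move=> qq; have qq' := quartering_tr _ qq.
pose q' x i j := q x j i; rewrite -/q'.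
have nz x u : quartering x -> forall a : B, a != \bot -> row_band x a u != \bot.
  move=> xx; elim: u => [|i u IHu] b b0 //=.
  by rewrite join_eq0 negb_and IHu // quarter_neq0.
elim: s t a => [|i s IHs] [|j t] a a0.
- by rewrite meetxx.
- by rewrite (meet_idPr (row_band_le qq' _ _)); apply: nz.
- by rewrite (meet_idPl (row_band_le qq _ _)); apply: nz.
have le_row : row_band q (q a i j) s <= row_band q a (i :: s).
  by case: (j); rewrite /= ?leUl ?leUr.
have le_col : row_band q' (q a i j) t <= row_band q' a (j :: t).
  by case: (i); rewrite /= ?leUl ?leUr.
have := IHs t (q a i j) (quarter_neq0 _ qq _ _ _ a0).
by apply: contra => /eqP x0; rewrite -lex0 -x0 leI2.
Qed.

(** * Idempotent ideals of the nil-Cantor ring *)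

Section NilCantor.
Local Open Scope ring_scope.
Context {k : fieldType} {d : Order.disp_t} {B : ctbDistrLatticeType d}.
Local Notation R := (nil_cantor k B).
Local Notation e := (@nc_basis k d B).

Lemma nc_max_ideal : is_ideal (nc_max k B).
Proof.
split=> [|u v /= u0 v0|u v /= v0]; first exact: (raddf0 (@nc_aug k d B)).
  by rewrite /nc_max /= raddfD /= u0 v0 addr0.
by rewrite /nc_max /= rmorphM /= v0 mulr0.
Qed.

Lemma nc_max_basis (b : B) : b != \bot%O -> nc_max k B (e b).
Proof. by move=> b0; rewrite /nc_max /= nc_aug_basis (negPf b0). Qed.

Lemma nc_max_le (I : set R) : is_ideal I ->
  (forall b : B, b != \bot%O -> I (e b)) -> nc_max k B `<=` I.
Proof.
move=> idI Ie u u0; rewrite (nc_basisE u); apply: ideal_big => // b _.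
have [->|b0] := eqVneq b \bot%O.
  rewrite -[u@_ _]/(nc_aug u) u0 scale0r; exact: ideal0.
by rewrite -[_ *: _]mulr_algl; apply: idealM => //; apply: Ie.
Qed.

Lemma nc_max_idem : atomless B -> ideal_mul (nc_max k B) (nc_max k B) = nc_max k B.
Proof.
move=> /atomless_split[h hP]; have idm := nc_max_ideal.
apply: idem_idl_of_sub => //; apply: nc_max_le; first exact: ideal_mul_ideal.
move=> b b0; have [bE b_disj /(_ b0) hb0] := hP b.
have -> : e b = e (h b false) * e (h b true).
  by rewrite nc_basisM b_disj eqxx -bE.
by apply: ideal_mul_gen; apply: nc_max_basis.
Qed.

(** The ring is local: modulo the square-zero elements [e_b], [b != 0], an
element outside the augmentation ideal is a nonzero scalar. *)
Lemma ideal_not_nc_max (I : set R) : is_ideal I -> ~ I `<=` nc_max k B ->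
  I = setT.
Proof.
move=> idI /nonsubset[u [Iu u0]].
suff [n] : exists n, I ((nc_aug u)%:A ^+ n).
  rewrite exprZn expr1n => In; apply/seteqP; split=> // v _.
  have un0 : nc_aug u ^+ n != 0 by rewrite expf_neq0 //; apply/eqP.
  have -> : v = (nc_aug u ^- n *: v) * (nc_aug u ^+ n)%:A.
    by rewrite -scalerAr mulr1 scalerA mulfV // scale1r.
  exact: idealM.
(* the terms of [u] other than its scalar part *)
pose r := [seq u@_b *: e b | b <- msupp u & b != \bot%O].
apply: (ideal_exp_nil _ r _ 1) => // [x /mapP[b]|].
  rewrite mem_filter => /andP[b0 _] ->.
  by rewrite -scalerAl -scalerAr nc_basisM meetxx (negPf b0) !scaler0.
suff -> : (nc_aug u)%:A + \sum_(x <- r) x = u by rewrite expr1.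
rewrite [RHS]nc_basisE big_map big_filter.
have uT : \bot%O \in msupp u by rewrite -mcoeff_neq0; apply/eqP.
by rewrite [RHS](bigD1_seq _ uT (fset_uniq _)).
Qed.


Definition bands (q : B -> bool -> bool -> B) (b : B) : set R :=
  [set e (row_band q b s) | s in setT].

Lemma bands_idem q b : quartering q ->
  ideal_mul (ideal_span (bands q b)) (ideal_span (bands q b)) =
  ideal_span (bands q b).
Proof.
move=> qq; apply: ideal_span_idem => _ [s _ <-].
exists (e (row_band q b (rcons s false))), (e (row_band q b (rcons s true))).
split; [by exists (rcons s false) | by exists (rcons s true) |].
by rewrite nc_basisM (row_band_disj qq) eqxx -(row_band_split qq).
Qed.

Lemma row_col_bands_mul0 q b : quartering q -> b != \bot%O ->
  forall x y, bands q b x -> bands (fun a i j => q a j i) b y -> x * y = 0.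
Proof.
move=> qq b0 _ _ [s _ <-] [t _ <-].
by rewrite nc_basisM (negPf (row_col_band_neq0 _ _ _ _ _ _ qq b0)).
Qed.

(** The ideals of horizontal and of vertical bands of [b]; both contain [e_b]
because the empty prefix gives the band [b] itself. *)
Lemma basis_idem_orthogonal (b : B) : atomless B -> b != \bot%O ->
  exists I J : idem_idl R, [/\ idl_set I (e b), idl_set J (e b) & (I `&` J = \bot)%O].
Proof.
move=> /atomless_quartering[q qq] b0; have qq' := quartering_tr _ qq.
exists (IdemIdl (ideal_span_ideal _) (bands_idem q b qq)).
exists (IdemIdl (ideal_span_ideal _) (bands_idem _ b qq')).
split; [by apply: ideal_span_gen; exists [::] ..|].
apply/eqP; rewrite -lex0; apply/idem_leP; rewrite idem_meetE.
apply: subset_trans (ideal_span_mul0 _ _ (row_col_bands_mul0 q b qq b0)) _.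
by move=> _ ->; apply: ideal0 (idl_ideal _).
Qed.

Lemma prime_nc_max (m : idem_idl R) : idl_set m = nc_max k B -> prime_elt m.
Proof.
move=> mE; split=> [|I J].
  rewrite lt_def lex1 andbT eq_sym; apply/eqP => mT.
  have : nc_max k B 1 by rewrite -mE mT.
  by rewrite /nc_max /= rmorph1; apply/eqP/oner_neq0.
move=> /idem_leP; rewrite idem_meetE mE => IJ.
apply: contrapT => /not_orP[/negP/idem_leP + /negP/idem_leP +]; rewrite mE.
move=> /nonsubset[u [Iu u0]] /nonsubset[v [Jv v0]].
have := IJ _ (ideal_mul_gen Iu Jv); rewrite /nc_max /= rmorphM /=.
by move=> /eqP; rewrite mulf_eq0 => /orP[]/eqP.
Qed.

End NilCantor.

(** * The unique point *)

(** Otherwise some [e_b] lies only in idempotent ideals sent to 1, and two of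
these have zero product. *)
Lemma pt_nc_max (k : fieldType) d (B : ctbDistrLatticeType d)
    (m : idem_idl (nil_cantor k B)) (p : pt (idem_idl (nil_cantor k B))) :
  atomless B -> idl_set m = nc_max k B -> p m = false.
Proof.
move=> aB mE; apply/negP => pm; pose j := joins [set I | p I = false].
suff mj : nc_max k B `<=` j.
  have := pt_joins_false p; rewrite -/j (pt_le p m j) //.
  by apply/idem_leP; rewrite mE.
apply: nc_max_le => [|b b0]; first exact: idl_ideal.
apply: contrapT => nj.
have p1 (I : idem_idl (nil_cantor k B)) : idl_set I (nc_basis b) -> p I.
  move=> Ib; apply/negP => /negP /negbTE pI; apply: nj.
  by have /idem_leP := joins_ub [set I | p I = false] I pI; apply.
have [I [J [/p1 pI /p1 pJ IJ]]] := @basis_idem_orthogonal k _ _ _ aB b0.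
by have := frame_homI p I J; rewrite IJ pt_bot pI pJ.
Qed.

Theorem proposition5p16 (k : fieldType) (d : Order.disp_t)
    (B : ctbDistrLatticeType d) (B_nontrivial : (\bot : B) <> \top)
    (B_atomless : atomless B) :
  exists (m : idem_idl (nil_cantor k B)) (m_prime : prime_elt m),
    idl_set m = nc_max k B /\
    [set: pt (idem_idl (nil_cantor k B))] = [set prime_point m_prime].
Proof.
pose m := IdemIdl nc_max_ideal (@nc_max_idem k _ _ B_atomless).
have m_prime : prime_elt m by exact: prime_nc_max.
exists m, m_prime; split=> //; apply/seteqP; split=> // p _.
apply: pt_inj => I; have pm : p m = false by exact: pt_nc_max.
rewrite -[RHS]/(~~ (I <= m)).
have [Im|/idem_leP Im] := boolP (I <= m).
  by apply/negP => /(pt_le p _ _ Im); rewrite pm.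
suff -> : I = \top by exact: frame_homT p.
by apply: idem_idl_inj; apply: ideal_not_nc_max => //; apply: idl_ideal.
Qed.
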